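(* For any $\varepsilon>0$ there exists $\alpha\in[0,1)$ such that $$\liminf_{n\to\infty}\ n\,\frac{\log n}{(\log\log\log n)^{1-\varepsilon}}\,\lVert n\alpha\rVert>0$$ (that is, $\alpha\in BAD_{\log/(\log\log\log)^{1-\varepsilon}}$) and $$\alpha\notin\bigcap_{\psi\in\mathcal{M}_{\mathbb{P}}}\mathcal{K}_{\mathbb{P}}(\psi).$$
   Context: $\mathbb{N}$ is the set of positive integers, $\mathbb{P}$ the set of primes, $\lVert x\rVert$ the distance from $x$ to the nearest integer, $\lambda$ the Lebesgue measure; ''monotonically decreasing'' means non-increasing. The function $\log\log\log n$ is considered only for $n\ge16$, where it is defined and positive. For a function $f$, $BAD_f:=\{\alpha:\liminf_{n\to\infty}nf(n)\lVert n\alpha\rVert>0\}$. $\mathcal{M}_{\mathbb{P}}:=\{\psi:\mathbb{N}\to[0,\infty)\text{ monotonically decreasing},\ \sum_{p\in\mathbb{P}}\psi(p)=\infty\}$, and $\mathcal{K}_{\mathbb{P}}(\psi)$ is the set of $\alpha\in[0,1)$ for which the set $\{\gamma\in[0,1):\lVert p\alpha+\gamma\rVert\le\psi(p)\text{ for infinitely many }p\in\mathbb{P}\}$ has Lebesgue measure $1$. *)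

(* Defs.v *)
(* MathComp-Analysis. *)
From HB Require Import structures.
From mathcomp Require Import all_boot all_order all_algebra.
From mathcomp Require Import all_classical all_reals all_analysis.
Set Implicit Arguments.
Unset Strict Implicit.
Unset Printing Implicit Defensive.
Import Order.TTheory GRing.Theory Num.Theory.
Import numFieldNormedType.Exports.
Local Open Scope classical_set_scope.
Local Open Scope ring_scope.

(* Distance from x to the nearest integer; the infimum is attained. *)
Definition dist_int (R : realType) (x : R) : R :=
  inf [set `|x - m%:~R| | m in [set: int]].

(* The lower limit is taken in the extended reals, since it may be +oo. *)
Definition BAD (R : realType) (f : nat -> R) : set R :=
  [set alpha | (0 < limn_einf
    (fun n : nat => (n%:R * f n * dist_int (n%:R * alpha))%:E))%E].

(* log n / (log log log n)^a.  As ln is totalized by 0, the values at n < 16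
   are junk; a lower limit does not see them. *)
Definition log_over_logloglog_pow (R : realType) (a : R) (n : nat) : R :=
  ln (n%:R : R) / (ln (ln (ln (n%:R : R))) `^ a).

(* Functions on the positive integers are represented by functions on nat
   whose value at 0 is unconstrained and never used. *)
Definition M_P (R : realType) : set (nat -> R) :=
  [set psi | [/\ forall n : nat, (0 < n)%N -> 0 <= psi n,
                 forall m n : nat, (0 < m)%N -> (m <= n)%N -> psi n <= psi m
               & (\sum_(0 <= p <oo | prime p) (psi p)%:E = +oo)%E]].

Definition K_P (R : realType) (psi : nat -> R) : set R :=
  [set alpha | 0 <= alpha < 1 /\
    lebesgue_measure
      [set gamma : R | 0 <= gamma < 1 /\
        infinite_set
          [set p : nat | prime p /\ dist_int (p%:R * alpha + gamma) <= psi p]]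
    = 1%E].

(* Main.v *)
Require Import Defs.
From mathcomp Require Import all_boot all_order all_algebra.
From mathcomp Require Import all_classical all_reals all_analysis.
From mathcomp Require Import zify ring lra.
Set Implicit Arguments.
Unset Strict Implicit.
Unset Printing Implicit Defensive.
Import Order.TTheory GRing.Theory Num.Theory.
Import numFieldNormedType.Exports.

(** The number alpha is a limit of fractions [p k / q k] in which a sparse set of
    denominators q k have unusually many small prime factors.

    Let Q = [q k] be a denominator divisible by P = [Y`!] and let N = [q k.+1].
    For n <= N one has n alpha = n (p k) / Q + O(1/Q).  If n is a prime larger
    than Y, then n (p k) is coprime to P, so the points n alpha with n prime,
    Y < n <= N, lie within O(1/Q) of the fractions v/Q with v coprime to P.  The
    set of gamma in [0,1) with ||n alpha + gamma|| <= 1/Q for some such n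
    therefore has measure O(totient P / P) = O(1 / log Y)
    ([mem_near_coprime], [near_coprime_measure]).  On the other hand, by
    Chebyshev's lower bound there are >> N / log N primes up to N, so giving psi
    the constant value 1/Q there contributes >> (N/Q) / log N to the sum of psi
    over the primes.

    The constraint on alpha is n log n ||n alpha|| >> (log log log n)^(1 - eps).
    It allows quotients N/Q as large as log Q / (log log log Q)^(1 - eps)
    ([dist_int_ge_denom], [BAD_scheduled]).  Making q divisible by P takes two
    steps of size O(P), one making q coprime to P and one reaching a multiple of
    P ([ex_coprime_step], [ex_dvdn_step]), so P has to be smaller than log Q;
    since P = Y!, this means that log Y can be of the order of log log log Q, and
    not more.  One such stage costs 1/log Y in measure and earns
    1/(log Y)^(1 - eps) in the sum.  Taking stages j = 0, 1, 2, ... with log Y of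
    the order of (j+1)^t, t = 1/(1 - eps), the total cost is a convergent series,
    whereas the total gain is the harmonic series; here one may assume that
    eps <= 1/2, as a larger eps only weakens the constraint.  Hence psi belongs
    to the class [M_P], but the gammas that are hit infinitely often are hit in
    every tail of the stages and form a set of measure less than 1
    ([scheduled_notin_bigcap_K_P]).

    The fractions satisfy the recurrence q_{k+2} = a_k q_{k+1} - q_k with
    a_k >= 5, the same for p.  The minus sign makes all the determinants
    p_{k+1} q_k - p_k q_{k+1} equal to 1, so the fractions increase to alpha.  The
    quotient a_k is 5 except in three consecutive steps for each stage. *)

(** * Chebyshev lower bound for the number of primes *)

Lemma exp2_le_bin (n : nat) : 2 ^ n <= 'C(n.*2, n).
Proof.
have le : 2 ^ n * (n`! * n`!) <= (n.*2)`!.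
  elim: n => // n IH; rewrite doubleS !factS expnS; nia.
rewrite -(@leq_pmul2r (n`! * n`!)) ?muln_gt0 ?fact_gt0 //.
have := @bin_fact n.*2 n; rewrite -addnn addnK leq_addr => /(_ isT) ->.
by rewrite addnn.
Qed.

(** In Legendre's formula each power of [p] up to [n.*2] contributes at most 1 to
    the valuation of the central binomial coefficient, the larger ones nothing. *)
Lemma pfactor_bin_le (n p : nat) : 0 < n -> prime p ->
  p ^ logn p 'C(n.*2, n) <= n.*2.
Proof.
move=> n0 pp; have p1 := prime_gt1 pp.
have n20 : 0 < n.*2 by rewrite double_gt0.
apply: leq_trans (trunc_logP p1 n20); rewrite leq_exp2l //.
set L := trunc_log p n.*2.
have nn : n <= n.*2 by rewrite -addnn leq_addr.
have lognn : logn p n`! = \sum_(1 <= k < n.*2.+1) n %/ p ^ k.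
  rewrite logn_fact // [RHS](@big_cat_nat _ _ _ n.+1) //= [X in _ + X]big_nat_cond.
  rewrite [X in _ + X]big1 ?addn0 // => k; rewrite andbT => /andP[nk _].
  by apply/divn_small/(ltn_trans nk)/ltn_expl.
have := bin_fact nn; rewrite -addnn addnK addnn => /(congr1 (logn p)).
rewrite !lognM ?muln_gt0 ?fact_gt0 ?bin_gt0 //= lognn logn_fact // => eq.
have le : \sum_(1 <= k < n.*2.+1) n.*2 %/ p ^ k <=
    \sum_(1 <= k < n.*2.+1) (2 * (n %/ p ^ k) + (k <= L)).
  apply: leq_sum => k _; case: (leqP k L) => [_|Lk].
    have pk : 0 < p ^ k by rewrite expn_gt0 prime_gt0.
    rewrite addn1 -ltnS ltn_divLR // {1}(divn_eq n (p ^ k)).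
    by have := ltn_pmod n pk; nia.
  rewrite divn_small //; apply: leq_trans (trunc_log_ltn _ p1) _.
  by rewrite leq_exp2l.
rewrite big_split /= -big_distrr /= in le.
have leL : \sum_(1 <= k < n.*2.+1) (k <= L : nat) <= L.
  rewrite big_add1 /=.
  have sum_min N : \sum_(0 <= k < N) (k < L : nat) = minn N L.
    elim: N => [|N IH]; first by rewrite big_geq // min0n.
    by rewrite big_nat_recr //= IH; lia.
  by rewrite sum_min geq_minr.
lia.
Qed.

(** The central binomial coefficient is at least [2 ^ n] and is a product of at
    most one factor [n.*2] for each prime up to [n.*2]. *)
Lemma prime_count_even_lower (n : nat) : 0 < n ->
  n <= (\sum_(0 <= p < n.*2.+1 | prime p) 1) * (trunc_log 2 n.*2).+1.
Proof.
move=> n0; set l := _.+1.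
rewrite -(@leq_exp2l 2) //.
apply: leq_trans (exp2_le_bin n) _.
set C := 'C(_, _).
have C0 : 0 < C by rewrite bin_gt0 -addnn leq_addr.
have -> : C = \prod_(0 <= p < (maxn C n.*2).+1 | prime p) p ^ logn p C.
  rewrite -[LHS]partnT // (@widen_partn (maxn C n.*2)) ?leq_maxl //.
  rewrite big_mkcond [RHS]big_mkcond; apply: eq_bigr => p _ /=.
  by case: ifP; rewrite // lognE => ->.
rewrite (@big_cat_nat _ _ _ n.*2.+1) ?ltnS ?leq_maxr //=.
rewrite [X in _ * X]big_nat_cond [X in _ * X]big1 ?muln1; last first.
  move=> p /andP[/andP[lt _] pp].
  have := pfactor_bin_le n0 pp; rewrite -/C.
  case: (logn p C) => // e; rewrite expnS => le.
  have p1 := prime_gt0 pp; have : 0 < p ^ e by rewrite expn_gt0 p1.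
  nia.
rewrite mulnC expnM; elim/big_rec2 : _ => // p y1 y2 pp le.
rewrite expnD expn1 leq_mul //.
apply: leq_trans (pfactor_bin_le n0 pp) _.
by apply/ltnW/trunc_log_ltn.
Qed.

Lemma chebyshev_lower_bound (n : nat) : 3 < n ->
  n <= 4 * (\sum_(0 <= p < n.+1 | prime p) 1) * (trunc_log 2 n).+1.
Proof.
move=> n3; have h0 : 0 < n./2 by lia.
have le := prime_count_even_lower h0.
have ln : (n./2).*2 <= n by rewrite -{2}(odd_double_half n) leq_addl.
have le1 : trunc_log 2 (n./2).*2 <= trunc_log 2 n by apply: leq_trunc_log.
have le2 : \sum_(0 <= p < (n./2).*2.+1 | prime p) 1 <= \sum_(0 <= p < n.+1 | prime p) 1.
  rewrite [X in _ <= X](@big_cat_nat _ _ _ (n./2).*2.+1) //=; exact: leq_addr.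
apply: (@leq_trans (4 * n./2)); first by lia.
by rewrite -mulnA leq_mul2l /=; apply: leq_trans le _; apply: leq_mul.
Qed.

(** * Integers coprime to a factorial *)

Lemma sum_coprime_mul (P t : nat) :
  \sum_(0 <= c < t * P) (coprime P c : nat) = t * totient P.
Proof.
elim: t => [|t IH]; first by rewrite mul0n big_geq.
rewrite !mulSn addnC (@big_cat_nat _ _ _ (t * P)) ?leq_addr //= IH addnC.
congr (_ + _).
rewrite -{1}[t * P]add0n big_addn addnC addnK.
rewrite totient_count_coprime; apply: eq_bigr => i _.
by rewrite /coprime addnC gcdnMDl.
Qed.

(** An integer has at most one factorization n c with n <= Y and c coprime to
    Y!, because c is then its largest divisor coprime to Y!.  Counting
    those products below P ^ 2 bounds the sum of the numbers of possible c.  It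
    is a substitute for the Euler product of the harmonic sum. *)
Lemma sum_totient_fact_le (Y : nat) (P := Y`!) : 1 < Y ->
  \sum_(i < Y) (P %/ i.+1) * totient P <= P * P.
Proof.
move=> Y1; have P0 : 0 < P by apply: fact_gt0.
have P1 : 1 < P by apply: (leq_trans Y1); rewrite /P; exact: fact_geq.
have dvdP (i : 'I_Y) : i.+1 %| P by apply: dvdn_fact; case: i.
pose D := [set u : 'I_Y * 'I_(P * P) |
  (u.1.+1 * u.2 < P * P) && coprime P u.2].
have cardD : \sum_(i < Y) (P %/ i.+1) * totient P <= #|D|.
  have -> : #|D| = \sum_(u : 'I_Y * 'I_(P * P))
     ((u.1.+1 * u.2 < P * P) && coprime P u.2 : nat).
    by rewrite -sum1_card big_mkcond /=; apply: eq_bigr => u _; rewrite inE; case: ifP.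
  rewrite -(pair_bigA _
     (fun (i : 'I_Y) (c : 'I_(P * P)) => ((i.+1 * c < P * P) && coprime P c : nat))) /=.
  apply: leq_sum => i _.
  rewrite -(big_mkord predT
     (fun c => ((i.+1 * c < P * P) && coprime P c : nat))).
  have le : P %/ i.+1 * P <= P * P by rewrite leq_mul2r leq_div orbT.
  rewrite (@big_cat_nat _ _ _ (P %/ i.+1 * P)) //=.
  apply: leq_trans (leq_addr _ _).
  rewrite -sum_coprime_mul big_nat_cond [X in _ <= X]big_nat_cond.
  apply: leq_sum => c; rewrite andbT /= => c_lt.
  suff -> : i.+1 * c < P * P by [].
  apply: (@leq_trans (i.+1 * (P %/ i.+1 * P))); first by rewrite ltn_mul2l.
  by rewrite mulnA [i.+1 * _]mulnC divnK.
apply: leq_trans cardD _.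
(* On D the product lies below P ^ 2, so the default value does not occur. *)
pose f (u : 'I_Y * 'I_(P * P)) : 'I_(P * P) :=
  insubd (Ordinal (ltn_ord u.2)) (u.1.+1 * u.2).
rewrite -[X in _ <= X]card_ord -(card_in_imset (f := f)) ?max_card //.
move=> [i c] [i' c']; rewrite !inE /= => /andP[lt co] /andP[lt' co'].
move=> /(congr1 val); rewrite /f !val_insubd /= lt lt' => eq.
have co_div (j : 'I_Y) (d : 'I_(P * P)) : coprime P d -> coprime d j.+1.
  by move=> Pd; rewrite coprime_sym (coprime_dvdl (dvdP j)).
have cc' : c = c'.
  apply/val_inj/eqP; rewrite eqn_dvd /=; apply/andP; split.
    by rewrite -(Gauss_dvdr c' (co_div i' c co)) -eq dvdn_mull.
  by rewrite -(Gauss_dvdr c (co_div i c' co')) eq dvdn_mull.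
have c0 : 0 < c.
  by rewrite lt0n; apply: contraL co => /eqP->; rewrite /coprime gcdn0 neq_ltn P1 orbT.
congr (_, _); last exact: cc'.
apply/val_inj; move/eqP: eq; rewrite cc' eqn_pmul2r -?cc' //.
by move/eqP=> [].
Qed.

Lemma sum_divn_ge (P m : nat) : (2 ^ m %| P) ->
  m * P <= 2 * \sum_(i < 2 ^ m) (P %/ i.+1).
Proof.
rewrite -(big_mkord predT (fun i => P %/ i.+1)).
elim: m => // m IH dvdP.
have /IH {}IH : 2 ^ m %| P by apply: dvdn_trans dvdP; rewrite dvdn_exp2l.
have le2 : 2 ^ m <= 2 ^ m.+1 by rewrite leq_exp2l.
rewrite (@big_cat_nat _ _ _ (2 ^ m)) //= mulnDr mulSn addnC leq_add //.
have : \sum_(2 ^ m <= i < 2 ^ m.+1) P %/ 2 ^ m.+1 <=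
       \sum_(2 ^ m <= i < 2 ^ m.+1) P %/ i.+1.
  rewrite big_nat_cond [X in _ <= X]big_nat_cond; apply: leq_sum => i.
  by rewrite andbT => /andP[_ lti]; apply: leq_div2l.
rewrite sum_nat_const_nat => le; apply: leq_trans (_ : 2 * _ <= _).
  2: by rewrite leq_mul2l; exact: le.
have -> : 2 ^ m.+1 - 2 ^ m = 2 ^ m by rewrite expnS mul2n -addnn addnK.
by rewrite mulnA -expnS mulnC divnK.
Qed.

(** The factorial of [2 ^ m] has a totient smaller by a factor of order [m], as
    Mertens's theorem predicts. *)
Lemma totient_fact_le (m : nat) : 0 < m ->
  m * totient (2 ^ m)`! <= 2 * (2 ^ m)`!.
Proof.
move=> m0; have Y1 : 1 < 2 ^ m by rewrite -{1}(expn0 2) ltn_exp2l.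
have P0 : 0 < (2 ^ m)`! by apply: fact_gt0.
have := @sum_totient_fact_le _ Y1; rewrite -big_distrl /= => sle.
have := @sum_divn_ge (2 ^ m)`! m _; rewrite dvdn_fact ?leqnn ?expn_gt0 // => /(_ isT).
set S := \sum_(_ < _) _ in sle *; move: sle.
set P := (2 ^ m)`! in P0 *; move=> le1 le2.
rewrite -(leq_pmul2r P0).
apply: leq_trans (_ : 2 * S * totient P <= _).
  by rewrite mulnAC leq_mul2r le2 orbT.
by rewrite -!mulnA leq_mul2l /= .
Qed.

Lemma prime_dvd_fact_le p n : prime p -> (p %| n`!)%N -> (p <= n)%N.
Proof.
move=> pp; elim: n => [|n IH].
  by rewrite dvdn1 => /eqP p1; rewrite p1 in pp.
by rewrite factS Euclid_dvdM // => /orP[/dvdn_leq->//|/IH /leqW].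
Qed.

(** * Steering a denominator modulo P *)

(** A prime r of [P] not dividing [x] should divide [a], and a prime dividing
    [x], hence not [y], should not; the part of [P] prime to [x] does this.  The
    multiple of [P] added to it makes [a] at least 5. *)
Lemma ex_coprime_step (x y P : nat) : 0 < x -> coprime x y -> x < y -> 0 < P ->
  exists a, [/\ 5 <= a, a <= 6 * P & coprime (a * y - x) P].
Proof.
move=> x0 co xy P0; pose a := P`_(\pi(x)^').
have a0 : 0 < a by apply: part_gt0.
have aP : a <= P by apply: dvdn_leq (dvdn_part _ _).
exists (5 * P + a); split; [lia | lia |].
have xlt : x < (5 * P + a) * y by nia.
apply/contraT; rewrite coprime_has_primes ?subn_gt0 // negbK => /hasP[r].
rewrite !mem_primes => /and3P[pr _ rP] /and3P[_ _ rz].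
have raE : (r %| (5 * P + a) * y) = (r %| x).
  by rewrite -(subnK (ltnW xlt)) dvdn_addr.
rewrite Euclid_dvdM // (dvdn_addr _ (dvdn_mull _ rP)) in raE.
have [rx|rx] := boolP (r %| x).
  have /negbTE ry : ~~ (r %| y).
    apply/negP => ry; have := prime_gt1 pr.
    by rewrite -(eqP co) ltnNge dvdn_leq ?gcdn_gt0 ?x0 // dvdn_gcd rx ry.
  move: raE; rewrite rx ry orbF => ra.
  have /pnatP := part_pnat (\pi(x)^') P; rewrite -/a => /(_ a0 r pr ra).
  by rewrite !inE /= mem_primes pr x0 rx.
have /norP[/negP ra _] : ~~ ((r %| a) || (r %| y)) by rewrite raE.
have rP' := rP; rewrite -(partnC \pi(x) P0) Euclid_dvdM // in rP'.
case/orP: rP' => // rb; have /pnatP := part_pnat (\pi(x)) P.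
move=> /(_ (part_gt0 _ _) r pr rb).
by rewrite !inE /= mem_primes pr x0 (negbTE rx).
Qed.

Lemma ex_dvdn_step (x y P : nat) : coprime y P -> x < y -> 0 < P ->
  exists a, [/\ 5 <= a, a <= 6 * P & P %| a * y - x].
Proof.
move=> co xy P0; have y0 : 0 < y by apply: leq_ltn_trans xy.
case: (egcdnP P y0) => u v eq _; rewrite (eqP co) in eq.
exists (5 * P + (x * u) %% P); split; first lia.
  by have := ltn_pmod (x * u) P0; lia.
rewrite -eqn_mod_dvd; last by nia.
by rewrite -modnMml modnMDl modn_mod modnMml -mulnA eq mulnDr mulnA modnMDl muln1.
Qed.

(** * Fractions with unit determinants *)

(** Convergents of a continued fraction with minus signs, written additively to
    stay within the natural numbers. *)
Definition convergents (a p q : nat -> nat) : Prop :=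
  [/\ p 0 = 0, p 1 = 1, q 0 = 1 & q 1 = 4] /\
  forall k, [/\ 5 <= a k, p k.+2 + p k = a k * p k.+1
              & q k.+2 + q k = a k * q k.+1].

(** The quotients may be chosen one at a time, each in view of the last two
    denominators; that these are coprime and increasing is maintained. *)
Lemma ex_convergents (rule : nat -> nat -> nat -> nat -> Prop) :
  (forall k x y, 0 < x -> x < y -> coprime x y ->
     exists a, 5 <= a /\ rule k x y a) ->
  exists a p q : nat -> nat,
    convergents a p q /\ forall k, rule k (q k) (q k.+1) (a k).
Proof.
move=> ex.
have /boolp.choice[f fP] : forall u : nat * (nat * nat), exists b,
    0 < u.2.1 -> u.2.1 < u.2.2 -> coprime u.2.1 u.2.2 ->
    5 <= b /\ rule u.1 u.2.1 u.2.2 b.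
  move=> [k [x y]] /=.
  have [[x0 [xy co]]|nP] := pselect (0 < x /\ x < y /\ coprime x y).
    by have [b bP] := ex k x y x0 xy co; exists b.
  by exists 0 => x0 xy co; case: nP.
pose step k (s : (nat * nat) * (nat * nat)) :=
  let b := f (k, s.2) in
  ((s.1.2, b * s.1.2 - s.1.1), (s.2.2, b * s.2.2 - s.2.1)).
pose st k := iteri k step ((0, 1), (1, 4)).
have stS k : st k.+1 = step k (st k) by [].
have inv k : [/\ 0 < (st k).2.1, (st k).2.1 < (st k).2.2,
     coprime (st k).2.1 (st k).2.2 & (st k).1.1 <= (st k).1.2].
  elim: k => [//|k [x0 xy co pp]]; rewrite stS /=.
  have [b5 _] := fP (k, (st k).2) x0 xy co.
  move: x0 xy co pp b5; set b := f _.
  case: (st k) => -[p p'] [x y] /= x0 xy co pp b5.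
  split; try nia.
  rewrite /coprime -dvdn1 -(eqP co) dvdn_gcd dvdn_gcdl andbT.
  have xle : x <= b * y by nia.
  by rewrite -{2}(subKn xle) dvdn_sub ?dvdn_gcdr // dvdn_mull ?dvdn_gcdl.
exists (fun k => f (k, (st k).2)), (fun k => (st k).1.1), (fun k => (st k).2.1).
split; last first.
  move=> k; have [x0 xy co pp] := inv k.
  by have [_] := fP (k, (st k).2) x0 xy co.
split=> // k; have [x0 xy co pp] := inv k.
have [b5 _] := fP (k, (st k).2) x0 xy co.
move: x0 xy co pp b5; rewrite !stS /=; set b := f _.
by case: (st k) => -[p p'] [x y] /= x0 xy co pp b5; split=> //; nia.
Qed.

Lemma convergents_growth a p q : convergents a p q ->
  forall k, 0 < q k /\ 4 * q k <= q k.+1.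
Proof.
move=> [[_ _ q0 q1] rec]; elim=> [|k [qk0 qk]]; first by rewrite q0 q1.
have [a5 _ eq] := rec k; split; nia.
Qed.

Lemma convergents_det a p q : convergents a p q ->
  forall k, p k.+1 * q k = p k * q k.+1 + 1.
Proof.
move=> [[p0 p1 q0 q1] rec]; elim=> [|k IH]; first by rewrite p0 p1 q0 q1.
have [a5 eqp eqq] := rec k.
have : (p k.+2 + p k) * q k.+1 = (q k.+2 + q k) * p k.+1.
  by rewrite eqp eqq mulnAC.
nia.
Qed.

Lemma convergents_coprime a p q : convergents a p q -> forall k, coprime (p k) (q k).
Proof.
move=> cv k; have det := convergents_det cv k.
rewrite /coprime -dvdn1 -(@dvdn_addr (p k * q k.+1)%N); last first.
  by rewrite dvdn_mulr // dvdn_gcdl.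
by rewrite -det dvdn_mull // dvdn_gcdr.
Qed.

Lemma exp2_le_denom a p q : convergents a p q -> forall k, 2 ^ k <= q k.
Proof.
move=> cv; elim=> [|k IH]; first by case: cv => -[_ _ ->].
by have [_] := convergents_growth cv k; rewrite expnS; nia.
Qed.

Lemma leq_log_denom a p q : convergents a p q ->
  forall k, k <= trunc_log 2 (q k).
Proof. by move=> cv k; apply: trunc_log_max => //; apply: (exp2_le_denom cv). Qed.

Lemma denom_mono a p q : convergents a p q -> {homo q : i j / i <= j}.
Proof.
move=> cv; apply: homo_leq => // [y x z|k]; first exact: leq_trans.
by have [_] := convergents_growth cv k; lia.
Qed.

Lemma denom_gap a p q : convergents a p q -> forall d k, 4 ^ d * q k <= q (k + d).
Proof.
move=> cv; elim=> [|d IH] k; first by rewrite mul1n addn0.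
rewrite addnS expnS; have [_] := convergents_growth cv (k + d).
by have := IH k; nia.
Qed.

Lemma leq_denom_quot a p q : convergents a p q -> forall k, q k.+2 <= a k * q k.+1.
Proof. by move=> [_ rec] k; have [_ _] := rec k; lia. Qed.

Lemma leq_quot_denom a p q : convergents a p q ->
  forall k, (a k).-1 * q k.+1 <= q k.+2.
Proof.
move=> cv k; have [_ le] := convergents_growth cv k.
by case: cv => _ rec; have [_ _] := rec k; nia.
Qed.

(** Quotients of logarithmic size increase [log2 (q k)] only by about
    log k at step k, so this logarithm stays polynomial in k and two more
    logarithms turn k and [q k] into quantities of the same order. *)
Lemma denom_le_exp2 a p q : convergents a p q ->
  (forall k, a k <= trunc_log 2 (q k.+1) + 5) ->
  forall k, q k <= 2 ^ (2 * k ^ 2).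
Proof.
move=> cv ale [|k]; first by case: cv => -[_ _ -> _] _.
elim: k => [|k IH]; first by case: cv => -[_ _ _ ->] _.
apply: leq_trans (leq_denom_quot cv k) _.
have q0 : 0 < q k.+1 by have [] := convergents_growth cv k.+1.
have le : trunc_log 2 (q k.+1) <= 2 * k.+1 ^ 2.
  by rewrite -(@leq_exp2l 2) //; apply: leq_trans (trunc_logP _ q0) IH.
apply: (@leq_trans (2 ^ (4 * k + 6) * 2 ^ (2 * k.+1 ^ 2))); last first.
  by rewrite -expnD leq_exp2l //; nia.
rewrite leq_mul //; apply: leq_trans (ale k) _.
apply: (@leq_trans (2 * k.+1 ^ 2 + 5)); first by rewrite leq_add2r.
have : k < 2 ^ k by apply: ltn_expl.
rewrite expnD [4 * k]mulnC expnM; set t := 2 ^ k.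
rewrite -[t ^ 4]/(t * (t * (t * t))) => kt.
have -> : 2 ^ 6 = 64 by [].
have : t * t <= t * (t * (t * t)) by nia.
rewrite -[k.+1 ^ 2]/(k.+1 * k.+1); nia.
Qed.

Lemma ex_denom_between a p q : convergents a p q ->
  forall n : nat, (4 <= n)%N -> exists k, (q k.+1 <= n < q k.+2)%N.
Proof.
move=> cv n n4.
have ex : exists k, (n < q k.+2)%N.
  exists n; have := exp2_le_denom cv n.+2.
  have : (n < 2 ^ n)%N by apply: ltn_expl.
  rewrite !expnS; lia.
case: (ex_minnP ex) => -[|k] lt min.
  by exists 0%N; case: cv => -[_ _ _ ->] _; rewrite n4.
by exists k.+1; rewrite lt andbT leqNgt; apply/negP => /min; rewrite ltnn.
Qed.

(** * The stages *)

(** The parameter [m] is log2 Y, where Y = [2 ^ m]. *)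
Definition modulus (m : nat) := (2 ^ m)`!.

(** The step at which the stage of parameter [m] begins: doubly exponential in
    [m], so that the denominators of the stage exceed [2 ^ modulus m] while their
    triple logarithm is still of order [m]. *)
Definition start (m : nat) := 2 ^ 8 ^ m.

Lemma fact_le_expn n : n`! <= n ^ n.
Proof.
elim: n => // n IH; rewrite factS expnS leq_mul //.
by apply: leq_trans IH _; case: n => // n; rewrite leq_exp2r.
Qed.

Lemma modulus_le_start (j m : nat) : j.+2 <= m ->
  6 * modulus m * j.+1 <= start m.
Proof.
move=> jm.
have le1 : modulus m <= 2 ^ (m * 2 ^ m).
  by rewrite expnM; apply: fact_le_expn.
have mlt : m < 2 ^ m by apply: ltn_expl.
apply: (@leq_trans (2 ^ (m + 3) * 2 ^ (m * 2 ^ m))).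
  rewrite mulnAC leq_mul // expnD; nia.
rewrite -expnD leq_exp2l //.
have -> : 8 ^ m = 2 ^ m * (2 ^ m * 2 ^ m) by rewrite -!expnMn.
have : 4 <= 2 ^ m by rewrite -[4]/(2 ^ 2) leq_exp2l //; lia.
nia.
Qed.

Lemma start_gap (m n : nat) : m < n -> start m + 3 <= start n.
Proof.
move=> mn; have e8 : (8 ^ m).+2 <= 8 ^ n.
  apply: (@leq_trans (8 ^ m.+1)); last by rewrite leq_exp2l.
  have : 0 < 8 ^ m by rewrite expn_gt0.
  by rewrite expnS; lia.
apply: (@leq_trans (2 ^ (8 ^ m).+2)); last by rewrite leq_exp2l.
have : 0 < 2 ^ 8 ^ m by rewrite expn_gt0.
by rewrite /start !expnS; lia.
Qed.

Lemma start_inj (m n : nat) : start m <= start n + 2 -> start n <= start m + 2 ->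
  m = n.
Proof.
by case: (ltngtP m n) => // /start_gap; lia.
Qed.

Lemma leq_start (j m : nat) : j <= m -> j <= start m.
Proof.
move=> jm; apply: leq_trans jm _; apply: ltnW.
apply: leq_trans (ltn_expl m (isT : 1 < 8)) _.
by apply/ltnW/ltn_expl.
Qed.

(** The stage j uses the steps [start (m j)], [start (m j) + 1] and
    [start (m j) + 2]: the first two prepare a denominator divisible by
    [modulus (m j)], the third makes the next denominator larger by a factor of
    about [log2 q / (j + 1)]. *)
Definition scheduled (m : nat -> nat) (a q : nat -> nat) : Prop :=
  [/\ forall j, modulus (m j) %| q (start (m j) + 3),
      forall j, a (start (m j) + 2) =
                trunc_log 2 (q (start (m j) + 3)) %/ j.+1 + 5
    & forall k, a k = 5 \/ exists j,
      [/\ start (m j) <= k, k <= start (m j) + 2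
        & a k <= trunc_log 2 (q k.+1) %/ j.+1 + 5]].

Lemma ex_scheduled (m : nat -> nat) :
  (forall j, j.+2 <= m j) -> injective m ->
  exists a p q : nat -> nat, convergents a p q /\ scheduled m a q.
Proof.
move=> jm injm.
pose P j := modulus (m j); pose K j := start (m j).
have P0 j : 0 < P j by apply: fact_gt0.
have K_inj i j : K i <= K j + 2 -> K j <= K i + 2 -> i = j.
  by move=> h1 h2; apply/injm/start_inj.
pose rule k x y a :=
  [/\ forall j, k = K j -> coprime (a * y - x) (P j),
      forall j, k = K j + 1 -> coprime y (P j) -> P j %| a * y - x,
      forall j, k = K j + 2 -> a = trunc_log 2 y %/ j.+1 + 5
    & a = 5 \/ exists j, [/\ K j <= k, k <= K j + 2 &
        (a <= 6 * P j) \/ a <= trunc_log 2 y %/ j.+1 + 5]].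
have [|a [p [q [cv ruleP]]]] := @ex_convergents rule.
  move=> k x y x0 xy co.
  have [[j kj]|nex] := pselect (exists j, K j <= k <= K j + 2); last first.
    exists 5; split=> //; split; last by left.
    - by move=> j kj; case: nex; exists j; lia.
    - by move=> j kj; case: nex; exists j; lia.
    - by move=> j kj; case: nex; exists j; lia.
  have uniq i : K i <= k <= K i + 2 -> i = j.
    by move=> ki; apply: K_inj; lia.
  have [kE|k0] := eqVneq k (K j).
    have [b [b5 bP cob]] := ex_coprime_step x0 co xy (P0 j).
    exists b; split=> //; split.
    - by move=> i ki; rewrite (uniq i) //; lia.
    - by move=> i ki; have ij := uniq i ltac:(lia); rewrite ij in ki; lia.
    - by move=> i ki; have ij := uniq i ltac:(lia); rewrite ij in ki; lia.
    - by right; exists j; split; [lia|lia|left].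
  have [kE|k1] := eqVneq k (K j + 1).
    have [coy|ncoy] := boolP (coprime y (P j)).
      have [b [b5 bP cob]] := ex_dvdn_step coy xy (P0 j).
      exists b; split=> //; split.
      - by move=> i ki; have ij := uniq i ltac:(lia); rewrite ij in ki; lia.
      - by move=> i ki; rewrite (uniq i) //; lia.
      - by move=> i ki; have ij := uniq i ltac:(lia); rewrite ij in ki; lia.
      - by right; exists j; split; [lia|lia|left].
    (* This does not occur along the sequence, where the preceding step makes y
       coprime to P j, but the rule must be satisfiable for arbitrary x and y. *)
    exists 5; split=> //; split; last by left.
    - by move=> i ki; have ij := uniq i ltac:(lia); rewrite ij in ki; lia.
    - by move=> i ki; rewrite (uniq i) ?(negbTE ncoy) //; lia.
    - by move=> i ki; have ij := uniq i ltac:(lia); rewrite ij in ki; lia.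
  exists (trunc_log 2 y %/ j.+1 + 5); split; first exact: leq_addl.
  split.
  - by move=> i ki; have ij := uniq i ltac:(lia); rewrite -ij ki eqxx in k0.
  - by move=> i ki; have ij := uniq i ltac:(lia); rewrite -ij ki eqxx in k1.
  - by move=> i ki; rewrite (uniq i) //; lia.
  - by right; exists j; split; [lia|lia|right].
have next k : a k * q k.+1 - q k = q k.+2.
  by case: cv => _ /(_ k)[_ _ <-]; rewrite addnK.
exists a, p, q; split=> //; split.
- move=> j; have [co _ _ _] := ruleP (K j); have [_ dv _ _] := ruleP (K j + 1).
  have := dv j erefl; rewrite next -!addnS; apply; rewrite addn2.
  by have := co j erefl; rewrite next.
- by move=> j; have [_ _ rj _] := ruleP (K j + 2); have := rj j erefl; rewrite -addnS; apply.
- move=> k; have [_ _ _ [->|[j [jk kj le]]]] := ruleP k; first by left.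
  right; exists j; split=> //; case: le => // le.
  apply: leq_trans le _; apply: leq_trans (leq_addr _ _).
  rewrite leq_divRL //; apply: leq_trans (modulus_le_start (jm j)) _.
  by apply: leq_trans (leq_log_denom cv k.+1); apply: leqW.
Qed.

Definition stage_denom (m : nat -> nat) (q : nat -> nat) (j : nat) := q (start (m j) + 3).

Definition stage_end (m : nat -> nat) (q : nat -> nat) (j : nat) := q (start (m j) + 4).

(** The end of a stage is about [log2 Q / (j + 1)] times its denominator Q, and
    Chebyshev's bound loses a factor of the order of [log2 Q]: what is left is of
    the order of [Q / (j + 1)]. *)
Lemma stage_end_primes m a p q : (forall j, j.+2 <= m j) -> convergents a p q ->
  scheduled m a q -> forall j, stage_denom m q j <=
    12 * j.+1 * \sum_(0 <= p < (stage_end m q j).+1 | prime p) 1.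
Proof.
move=> jm cv [_ aE _] j; set Q := stage_denom m q j; set N := stage_end m q j.
set k := start (m j).
have aj := aE j; have le1 := leq_denom_quot cv (k + 2); have le2 := leq_quot_denom cv (k + 2).
rewrite -/k in aj; rewrite aj -!addnS in le1 le2.
rewrite -/Q -/N in le1 le2; set l := trunc_log 2 Q in aj le1 le2.
have l4 : 4 <= l.
  apply: leq_trans (leq_log_denom cv _); rewrite -/k.
  by have := leq_start (jm j); rewrite -/k; lia.
have Q0 : 0 < Q by have [] := convergents_growth cv (k + 3).
have dl : l <= (l %/ j.+1).+1 * j.+1 by apply/ltnW/ltn_ceil.
have NQ : l * Q <= j.+1 * N.
  apply: (@leq_trans (j.+1 * ((l %/ j.+1 + 5).-1 * Q))); last by rewrite leq_mul2l le2 orbT.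
  rewrite mulnA leq_mul2r mulnC; apply/orP; right; apply: leq_trans dl _.
  by rewrite leq_mul2r; apply/orP; right; set d := _ %/ _; lia.
have N4 : 3 < N.
  have : 2 ^ (k + 4) <= N by apply: exp2_le_denom cv _.
  have : 0 < 2 ^ k by rewrite expn_gt0.
  by rewrite expnD; lia.
have lN : (trunc_log 2 N).+1 <= 3 * l.
  have : N < 2 ^ (2 * l + 2).
    apply: leq_ltn_trans le1 _.
    have l2 : l + 5 <= 2 ^ l.+1.
      by rewrite expnS; have := ltn_expl l (isT : 1 < 2); lia.
    have Ql : Q < 2 ^ l.+1 by apply: trunc_log_ltn.
    have la : l %/ j.+1 + 5 <= l + 5 by rewrite leq_add2r leq_div.
    have -> : 2 ^ (2 * l + 2) = 2 ^ l.+1 * 2 ^ l.+1 by rewrite -expnD; congr (2 ^ _); lia.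
    apply: (@leq_ltn_trans (2 ^ l.+1 * Q)); last by rewrite ltn_mul2l expn_gt0.
    by rewrite leq_mul2r (leq_trans la l2) orbT.
  have tN : 2 ^ trunc_log 2 N <= N by apply: trunc_logP => //; lia.
  move=> lt; have := leq_ltn_trans tN lt; rewrite ltn_exp2l //; lia.
have := chebyshev_lower_bound N4; set pi := \sum_(_ <= _ < _ | _) _ => le.
have : l * Q <= l * (12 * j.+1 * pi).
  apply: leq_trans NQ _; apply: (@leq_trans (j.+1 * (4 * pi * (3 * l)))); last by lia.
  by rewrite leq_mul2l (leq_trans le) ?orbT // leq_mul2l lN orbT.
by rewrite leq_pmul2l //; lia.
Qed.

(** The end of a stage is so small in comparison with the next stage that removing
    the primes below it costs at most half of the primes. *)
Lemma stage_primes m a p q : (forall j, j.+2 <= m j) -> (forall j, m j < m j.+1) ->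
  convergents a p q -> scheduled m a q -> forall j, stage_denom m q j.+1 <=
    24 * j.+2 * \sum_((stage_end m q j).+1 <= p < (stage_end m q j.+1).+1 | prime p) 1.
Proof.
move=> jm mlt cv sch j.
have := stage_end_primes jm cv sch j.+1.
set Q := stage_denom m q j.+1; set N := stage_end m q j; set N' := stage_end m q j.+1.
have startS : 4 * start (m j) <= start (m j.+1).
  have -> : 4 * start (m j) = 2 ^ (8 ^ m j + 2) by rewrite expnD mulnC.
  rewrite leq_exp2l // (@leq_trans (8 ^ (m j).+1)) ?leq_exp2l //.
  have : 0 < 8 ^ m j by rewrite expn_gt0.
  by rewrite expnS; lia.
have jK : j.+2 <= start (m j) by apply: leq_start.
have NQ : 48 * j.+2 * N <= Q.
  have := denom_gap cv (2 * start (m j)) (start (m j) + 4).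
  have : q (start (m j) + 4 + 2 * start (m j)) <= Q by apply: (denom_mono cv); lia.
  have : 48 * j.+2 <= 4 ^ (2 * start (m j)).
    rewrite expnM; apply: (@leq_trans (4 ^ 4 * (4 ^ 2) ^ j)).
      by have := ltn_expl j (isT : 1 < 4 ^ 2); lia.
    rewrite -expnM -expnD -expnM leq_exp2l //.
    by rewrite -[4]/(2 * 2) -mulnDr leq_mul2l add2n jK.
  by move=> h1 h2 h3; apply: leq_trans h2; apply: leq_trans h3; rewrite leq_mul2r h1 orbT.
have NN' : N.+1 <= N'.+1 by rewrite ltnS; apply: (denom_mono cv); lia.
rewrite [in X in X -> _](@big_cat_nat _ _ _ N.+1) //=.
set pi := \sum_(N.+1 <= _ < _ | _) _.
have : \sum_(0 <= p < N.+1 | prime p) 1 <= N.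
  rewrite big_ltn_cond //= (leq_trans (_ : _ <= \sum_(1 <= i < N.+1) 1)) //.
    rewrite [X in _ <= X](bigID prime) /= leq_addr //.
  by rewrite sum_nat_const_nat muln1 subn1.
nia.
Qed.

Lemma stage_end_mono m a p q : convergents a p q -> {homo m : i j / (i <= j)%N} ->
  {homo stage_end m q : i j / (i <= j)%N}.
Proof.
move=> cv mono i j ij; apply: (denom_mono cv); rewrite leq_add2r.
by rewrite leq_exp2l // leq_exp2l // mono.
Qed.

Lemma stage_end_unbounded m a p q : (forall j, (j.+2 <= m j)%N) -> convergents a p q ->
  forall n, exists j, (n <= stage_end m q j)%N.
Proof.
move=> jm cv n; exists n; apply: leq_trans (exp2_le_denom cv _).
apply: ltnW; apply: leq_trans (ltn_expl n (isT : 1 < 2)%N) _.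
rewrite leq_exp2l //; apply: leq_trans (leq_addr _ _).
by apply: leq_start; do 2!apply: ltnW.
Qed.

(** Valid for every step up to the end of stage j; it bounds the triple logarithm
    of the integers that occur there by [3 * m j + 3]. *)
Lemma denom_schedule_le m a p q : convergents a p q -> scheduled m a q ->
  forall j k, (k <= start (m j) + 2)%N -> (q k.+2 <= 2 ^ 2 ^ 2 ^ (3 * m j + 3))%N.
Proof.
move=> cv [_ _ ale] j k kj.
have le : forall i, (a i <= trunc_log 2 (q i.+1) + 5)%N.
  move=> i; case: (ale i) => [->|[j' [_ _ h]]]; first by rewrite leq_addl.
  by apply: leq_trans h _; rewrite leq_add2r leq_div.
apply: leq_trans (denom_le_exp2 cv le _) _; rewrite leq_exp2l //.
have K2 : (2 <= start (m j))%N by rewrite -{1}(expn1 2) leq_exp2l // expn_gt0.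
apply: (@leq_trans (2 * (3 * start (m j)) ^ 2)).
  by rewrite leq_mul2l /= leq_sqr; lia.
rewrite expnMn; apply: (@leq_trans (2 ^ 5 * start (m j) ^ 2)).
  by rewrite mulnA leq_mul2r orbC.
rewrite /start -expnM -expnD leq_exp2l // expnD expnM -[(2 ^ 3)%N]/8%N.
have : (0 < 8 ^ m j)%N by rewrite expn_gt0.
lia.
Qed.

Local Open Scope classical_set_scope.
Local Open Scope ring_scope.

(** * The limit and its distance to the integers *)

Definition converges_to (R : realType) (p q : nat -> nat) (alpha : R) : Prop :=
  forall k, 0 <= alpha - (p k)%:R / (q k)%:R <= 2 / ((q k)%:R * (q k.+1)%:R).

(** The fractions increase, and adding [2 / (q k * q k.+1)] to them
    makes them decrease, so alpha is the common point of nested intervals. *)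
Lemma ex_converges_to (R : realType) a p q : convergents a p q ->
  exists alpha : R, converges_to p q alpha.
Proof.
move=> cv; pose u k : R := (p k)%:R / (q k)%:R.
pose v k : R := u k + 2 / ((q k)%:R * (q k.+1)%:R).
have q0 k : 0 < (q k)%:R :> R.
  by rewrite ltr0n; have [] := convergents_growth cv k.
have uS k : u k.+1 = u k + ((q k)%:R * (q k.+1)%:R)^-1.
  have := convergents_det cv k => /(congr1 (fun n => n%:R : R)).
  rewrite natrD !natrM => det; rewrite /u.
  have -> : (p k.+1)%:R = ((p k)%:R * (q k.+1)%:R + 1) / (q k)%:R :> R.
    by rewrite -det mulfK // gt_eqF.
  by field; rewrite !gt_eqF.
have vS k : v k.+1 <= v k.
  rewrite /v uS -addrA lerD2l.
  have -> : 2 / ((q k)%:R * (q k.+1)%:R) =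
    ((q k)%:R * (q k.+1)%:R)^-1 + ((q k)%:R * (q k.+1)%:R)^-1 :> R.
    by rewrite mulrDl mul1r.
  rewrite lerD2l.
  have -> : ((q k)%:R * (q k.+1)%:R)^-1 = 2 / ((q k.+1)%:R * (2 * (q k)%:R)) :> R.
    by field; rewrite !gt_eqF.
  rewrite ler_pM2l // lef_pV2 ?posrE ?mulr_gt0 // ler_pM2l //.
  have [_] := convergents_growth cv k; have [_] := convergents_growth cv k.+1.
  rewrite -!(ler_nat R) !natrM; have := q0 k; lra.
have u_le_v k : u k <= v k.
  by rewrite /v lerDl divr_ge0 ?mulr_ge0 // ltW.
have u_mono : {homo u : i j / (i <= j)%N >-> i <= j}.
  apply: homo_leq => [//|y x z|k]; first exact: le_trans.
  by rewrite uS lerDl invr_ge0 mulr_ge0 // ltW.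
have v_mono : {homo v : i j / (i <= j)%N >-> j <= i}.
  by apply: (@homo_leq _ _ (fun x y => y <= x)) => // y x z h1 h2; exact: le_trans h2 h1.
have uv i j : u i <= v j.
  have [ij|/ltnW ji] := leqP i j; first exact: le_trans (u_mono _ _ ij) _.
  exact: le_trans (u_le_v _) (v_mono _ _ ji).
have ub : has_sup (range u).
  by split; [exists (u 0%N); exists 0%N | exists (v 0%N) => _ [i _ <-]].
exists (sup (range u)) => k; apply/andP; split.
  by rewrite subr_ge0; apply: sup_upper_bound => //; exists k.
rewrite lerBlDl; apply: ge_sup; first by exists (u 0%N); exists 0%N.
by move=> _ [i _ <-]; apply: uv.
Qed.

Lemma dist_int_ge (R : realType) (x c : R) :
  (forall m : int, c <= `|x - m%:~R|) -> c <= dist_int x.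
Proof.
move=> le; apply: lb_le_inf; first by exists `|x - 0%:~R|, 0.
by move=> _ [m _ <-].
Qed.

Lemma dist_int_lt (R : realType) (x c : R) :
  dist_int x < c -> exists m : int, `|x - m%:~R| < c.
Proof.
have ne : [set `|x - m%:~R| | m in [set: int]] !=set0.
  by exists `|x - 0%:~R|, 0.
by move=> /(inf_lt ne) [_ [m _ <-] lt]; exists m.
Qed.

(** The number n (p k.+1) / (q k.+1) is at distance at least 1 / (q k.+1) from the
    integers, and n alpha differs from it by at most half as much because
    [q k.+2] is at least 4 times [q k.+1]. *)
Lemma dist_int_ge_denom (R : realType) a p q (alpha : R) :
  convergents a p q -> converges_to p q alpha ->
  forall k n : nat, (0 < n)%N -> (n < q k.+1)%N ->
  (2 * (q k.+1)%:R)^-1 <= dist_int (n%:R * alpha).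
Proof.
move=> cv al k n n0 nq; apply: dist_int_ge => m.
have q0 i : 0 < (q i)%:R :> R.
  by rewrite ltr0n; have [] := convergents_growth cv i.
pose z : int := n%:Z * (p k.+1)%:Z - m * (q k.+1)%:Z.
have z0 : z != 0.
  apply/eqP => z0; have det := convergents_det cv k.
  have eq : n%:Z = (q k.+1)%:Z * (m * (q k)%:Z - n%:Z * (p k)%:Z).
    move: z0; rewrite /z => z0.
    have : (p k.+1)%:Z * (q k)%:Z = (p k)%:Z * (q k.+1)%:Z + 1 by lia.
    nia.
  move: eq; set w := (_ - _) => eq.
  have : (w <= 0) || (1 <= w) by lia.
  case/orP => w1; nia.
have z1 : 1 <= `|z%:~R : R|.
  by rewrite -intr_norm -[1]/(1%:~R) ler_int; lia.
set e : R := alpha - (p k.+1)%:R / (q k.+1)%:R.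
have /andP[e0 e1] : 0 <= e <= 2 / ((q k.+1)%:R * (q k.+2)%:R) := al k.+1.
have -> : n%:R * alpha - m%:~R = z%:~R / (q k.+1)%:R + n%:R * e.
  rewrite /z /e rmorphB !rmorphM /= -!pmulrn.
  by field; rewrite gt_eqF.
have ne : n%:R * e <= (2 * (q k.+1)%:R)^-1.
  apply: (@le_trans _ _ ((q k.+1)%:R * (2 / ((q k.+1)%:R * (q k.+2)%:R)))).
    by apply: ler_pM => //; rewrite ler_nat ltnW.
  have -> : (q k.+1)%:R * (2 / ((q k.+1)%:R * (q k.+2)%:R)) = 2 / (q k.+2)%:R :> R.
    by field; rewrite !gt_eqF.
  rewrite ler_pdivrMr // mulrC ler_pdivlMr ?mulr_gt0 //.
  have [_] := convergents_growth cv k.+1; rewrite -(ler_nat R) natrM; lra.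
have ne0 : 0 <= n%:R * e by rewrite mulr_ge0.
have half : (q k.+1)%:R^-1 = (2 * (q k.+1)%:R)^-1 + (2 * (q k.+1)%:R)^-1 :> R.
  by field; rewrite gt_eqF.
have : (q k.+1)%:R^-1 <= `|z%:~R / (q k.+1)%:R : R|.
  by rewrite normrM normfV [`|(q k.+1)%:R|]gtr0_norm // ler_peMl // invr_ge0 ltW.
move=> h; have := lerB_normD (z%:~R / (q k.+1)%:R : R) (n%:R * e).
rewrite [`|n%:R * e|]ger0_norm //; lra.
Qed.

(** * Lower limits and iterated logarithms *)

Lemma limn_einf_ge (R : realType) (u : nat -> \bar R) (c : \bar R) (n0 : nat) :
  (forall n, (n0 <= n)%N -> (c <= u n)%E) -> (c <= limn_einf u)%E.
Proof.
move=> le; rewrite limn_einf_lim; apply: lime_ge; first exact: is_cvg_einfs.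
near=> n; apply: le_ereal_inf_tmp => _ [k /= nk <-]; apply: le.
by apply: leq_trans nk; near: n; exact: nbhs_infty_ge.
Unshelve. all: by end_near.
Qed.

Lemma ln2_bounds (R : realType) : 2^-1 <= ln (2 : R) <= 1.
Proof.
apply/andP; split.
  have := @le_ln1Dx R (- 2^-1); have -> : 1 - 2^-1 = 2^-1 :> R by lra.
  by rewrite lnV ?posrE // lerN2; apply; lra.
by have := @le_ln1Dx R 1; rewrite -[1 + 1]/2; apply; lra.
Qed.

Lemma ln_le_nat (R : realType) (x : R) (k : nat) : x <= (2 ^ k)%:R -> ln x <= k%:R.
Proof.
move=> xk; have [x0|x0] := leP x 0; first by rewrite ln0.
apply: (@le_trans _ _ (ln (2 ^ k)%:R)).
  by rewrite ler_ln ?posrE // ltr0n expn_gt0.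
rewrite natrX lnXn // ler_wMn2r //.
by have /andP[] := ln2_bounds R.
Qed.

Lemma logloglog_le (R : realType) (n s : nat) : (n <= 2 ^ 2 ^ 2 ^ s)%N ->
  ln (ln (ln n%:R)) <= s%:R :> R.
Proof. by move=> le; do 3!apply: ln_le_nat; rewrite ler_nat. Qed.

Lemma logloglog_ge1 (R : realType) :
  exists n0 : nat, forall n, (n0 <= n)%N ->
    [/\ (4 <= n)%N, 1 <= ln (ln (ln n%:R)) :> R
      & ln (ln (ln n%:R)) <= ln n%:R :> R].
Proof.
have lnS (x : R) : 0 < x -> ln x <= x.
  move=> x0; have := @le_ln1Dx R (x - 1); rewrite [1 + _]addrC subrK => h.
  apply: le_trans (h _) _; lra.
have ln_ge (x y : R) : expR y <= x -> y <= ln x.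
  move=> le; rewrite -[leLHS]expRK ler_ln ?posrE ?expR_gt0 //.
  exact: lt_le_trans (expR_gt0 _) le.
exists (maxn 4 (Num.truncn (expR (expR (expR 1)) : R)).+1) => n.
rewrite geq_max => /andP[n4 len]; split=> //.
  do 3!apply: (ln_ge _ _); apply/ltW; apply: lt_le_trans (truncnS_gt _) _.
  by rewrite ler_nat.
have n_ge : expR (expR (expR 1)) <= n%:R :> R.
  by apply/ltW; apply: lt_le_trans (truncnS_gt _) _; rewrite ler_nat.
have l1 := ln_ge _ _ n_ge; have l2 := ln_ge _ _ l1.
apply: le_trans (lnS _ _) (lnS _ _).
  exact: lt_le_trans (expR_gt0 _) l2.
exact: lt_le_trans (expR_gt0 _) l1.
Qed.

(** A quotient equal to 5 is harmless since the weight is at least 1.  A quotient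
    of stage j is about [log2 (q k.+1) / (j + 1)], and the hypothesis on [beta]
    says that j + 1 dominates the power of the triple logarithm. *)
Lemma quotient_le_weight (R : realType) (b beta C : R) m a p q :
  (forall j, (j.+2 <= m j)%N) -> convergents a p q -> scheduled m a q ->
  b <= beta <= 1 -> 0 <= beta -> 1 <= C ->
  (forall j, (3 * m j + 3)%:R `^ beta <= C * j.+1%:R) ->
  exists n0 : nat, forall k n : nat, (n0 <= n)%N -> (q k.+1 <= n < q k.+2)%N ->
    (a k)%:R <= 12 * C * log_over_logloglog_pow b n.
Proof.
move=> jm cv sch /andP[bbeta beta1] beta0 C1 mC.
have C0 : 0 < C by apply: lt_le_trans C1.
have [n0 n0P] := logloglog_ge1 R; exists n0 => k n /n0P[n4 L1 Lle] /andP[qn nq].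
rewrite /log_over_logloglog_pow; set L := ln (ln (ln n%:R)) in L1 Lle *.
have Lb0 : 0 < L `^ b by rewrite powR_gt0 // (lt_le_trans ltr01).
have Lbeta : L `^ b <= L `^ beta by apply: ler_powR.
have [_ _ /(_ k)] := sch; case=> [->|[j [jk kj ale]]].
  have f1 : 1 <= ln n%:R / L `^ b.
    rewrite ler_pdivlMr // mul1r (le_trans Lbeta) // (le_trans _ Lle) //.
    by apply: ler1_powR.
  have : 1 * 1 <= C * (ln n%:R / L `^ b) by apply: ler_pM.
  rewrite -mulrA -[5%:R]/5; lra.
set l := trunc_log 2 (q k.+1) in ale.
have jl : (j < l)%N.
  apply: leq_trans (leq_log_denom cv k.+1); rewrite ltnS (leq_trans _ jk) //.
  have mj : (j <= m j)%N by do 2!apply: ltnW.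
  apply: leq_trans mj _; apply: ltnW; apply: leq_trans (ltn_expl _ (isT : 1 < 8)%N) _.
  by apply/ltnW/ltn_expl.
have q0 : (0 < q k.+1)%N by have [] := convergents_growth cv k.+1.
have lnn : l%:R / 2 <= ln n%:R :> R.
  have : ln (2 ^ l)%:R <= ln n%:R :> R.
    rewrite ler_ln ?posrE ?ltr0n ?expn_gt0 //; last by apply: leq_trans n4.
    by rewrite ler_nat (leq_trans _ qn) // trunc_logP.
  apply: le_trans; rewrite natrX lnXn // -[ln 2 *+ l]mulr_natl ler_wpM2l //.
  by have /andP[] := ln2_bounds R.
have Lb : L `^ b <= C * j.+1%:R.
  apply: le_trans Lbeta _; apply: le_trans (mC j).
  apply: ge0_ler_powR; rewrite ?nnegrE //; first exact: le_trans L1.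
  apply: logloglog_le; apply: leq_trans (ltnW nq) _.
  exact: (denom_schedule_le cv sch).
have j0 : 0 < j.+1%:R :> R by rewrite ltr0n.
have aR : (a k)%:R * j.+1%:R <= 6 * l%:R :> R.
  rewrite -[6]/(6%:R) -!natrM ler_nat.
  by have := leq_trunc_div l j.+1; clear -ale jl; nia.
rewrite mulrA ler_pdivlMr //.
apply: (@le_trans _ _ ((a k)%:R * (C * j.+1%:R))); first by rewrite ler_wpM2l.
rewrite mulrCA [12 * C]mulrC -mulrA ler_pM2l //; lra.
Qed.

(** Between two denominators, n ||n alpha|| is at least half of their ratio, hence
    at least the inverse of twice the quotient of the step. *)
Lemma BAD_scheduled (R : realType) (b beta C alpha : R) m a p q :
  (forall j, (j.+2 <= m j)%N) -> convergents a p q -> converges_to p q alpha ->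
  scheduled m a q ->
  b <= beta <= 1 -> 0 <= beta -> 1 <= C ->
  (forall j, (3 * m j + 3)%:R `^ beta <= C * j.+1%:R) ->
  BAD (log_over_logloglog_pow b) alpha.
Proof.
move=> jm cv al sch bbeta beta0 C1 mC.
have C0 : 0 < C by apply: lt_le_trans C1.
have [n0 n0P] := quotient_le_weight jm cv sch bbeta beta0 C1 mC.
have c0 : 0 < (24 * C)^-1 by rewrite invr_gt0 mulr_gt0.
apply: (@lt_le_trans _ _ (24 * C)^-1%:E); first by rewrite lte_fin.
apply: (@limn_einf_ge _ _ _ (maxn 4 n0)) => n; rewrite geq_max => /andP[n4 nn0].
have [k /[dup] kn /andP[qn nq]] := ex_denom_between cv n4.
have af := n0P k n nn0 kn.
have n_gt0 : (0 < n)%N by apply: leq_trans n4.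
have dist := dist_int_ge_denom cv al n_gt0 nq.
rewrite lee_fin; set f := log_over_logloglog_pow b n in af *.
have q0 i : 0 < (q i)%:R :> R.
  by rewrite ltr0n; have [] := convergents_growth cv i.
have a0 : 0 < (a k)%:R :> R.
  by rewrite ltr0n; case: cv => _ /(_ k)[a5 _ _]; apply: leq_trans a5.
have f0 : 0 <= f.
  by rewrite -(pmulr_rge0 _ (_ : 0 < 12 * C)) ?mulr_gt0 // (le_trans _ af) // ltW.
apply: (@le_trans _ _ ((q k.+1)%:R * f * (2 * (a k)%:R * (q k.+1)%:R)^-1)).
  have -> : (q k.+1)%:R * f * (2 * (a k)%:R * (q k.+1)%:R)^-1 = f / (2 * (a k)%:R) :> R.
    by field; rewrite !gt_eqF.
  rewrite ler_pdivlMr ?mulr_gt0 // mulrC ler_pdivrMr ?mulr_gt0 //; lra.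
apply: ler_pM => //.
- by rewrite mulr_ge0 // ltW.
- by rewrite ler_wpM2r // ler_nat.
apply: le_trans dist; rewrite lef_pV2 ?posrE ?mulr_gt0 // -mulrA ler_pM2l //.
by rewrite -natrM ler_nat (leq_denom_quot cv).
Qed.

(** * Measure of the shifts that are hit during one stage *)

(** Windows are indexed by v = u + P instead of u, where u/Q is the nearby fraction
    and u may be slightly negative. *)
Definition coprime_window (R : realType) (P Q v : nat) : set R :=
  if coprime P v
  then `](v%:R - P%:R - 4) / Q%:R, (v%:R - P%:R + 2) / Q%:R[%classic else set0.
Arguments coprime_window : clear implicits.

Definition near_coprime (R : realType) (P Q : nat) : set R :=
  \big[setU/set0]_(v < Q + 2 * P) coprime_window R P Q v.
Arguments near_coprime : clear implicits.

(** The integer u = m Q - n (p k), where m is close to n alpha + gamma, is coprime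
    to P, and gamma differs from u/Q by less than 4/Q: 2/Q for the proximity
    to m and 2/Q for n times the error of the fraction. *)
Lemma mem_near_coprime (R : realType) a p q (alpha gamma : R) (P k n : nat) :
  convergents a p q -> converges_to p q alpha ->
  (4 <= P)%N -> (P %| q k)%N -> coprime n P -> (n <= q k.+1)%N ->
  0 <= gamma < 1 -> dist_int (n%:R * alpha + gamma) <= (q k)%:R^-1 ->
  near_coprime R P (q k) gamma.
Proof.
move=> cv al P4 PQ nP nQ /andP[g0 g1] dist.
have q0 i : 0 < (q i)%:R :> R.
  by rewrite ltr0n; have [] := convergents_growth cv i.
(* The factor 2 leaves room to pass from the infimum to an actual integer m. *)
have [m /ltr_normlP[m1 m2]] : exists m : int,
    `|n%:R * alpha + gamma - m%:~R| < 2 / (q k)%:R.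
  apply: dist_int_lt; apply: le_lt_trans dist _.
  by rewrite ltr_pMl ?invr_gt0 // ltr1n.
have /andP[] := al k; set e := alpha - _ => e0 e1.
have ne0 : 0 <= n%:R * e by rewrite mulr_ge0.
have ne1 : n%:R * e <= 2 / (q k)%:R.
  apply: (@le_trans _ _ ((q k.+1)%:R * (2 / ((q k)%:R * (q k.+1)%:R)))).
    by apply: ler_pM => //; rewrite ler_nat.
  by rewrite le_eqVlt; apply/orP; left; apply/eqP; field; rewrite !gt_eqF.
have alE : alpha = (p k)%:R / (q k)%:R + e by rewrite /e; ring.
pose u : int := m * (q k)%:Z - n%:Z * (p k)%:Z.
have uE : u%:~R = m%:~R * (q k)%:R - n%:R * (p k)%:R :> R.
  by rewrite /u rmorphB !rmorphM /= -!pmulrn.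
have g_lo : (u%:~R - 4) / (q k)%:R < gamma.
  rewrite ltr_pdivrMr // uE.
  have : (- (n%:R * alpha + gamma - m%:~R)) * (q k)%:R < 2 by rewrite -ltr_pdivlMr.
  have : n%:R * e * (q k)%:R <= 2 by rewrite -ler_pdivlMr.
  have -> : n%:R * alpha = n%:R * (p k)%:R / (q k)%:R + n%:R * e by rewrite alE; ring.
  have : n%:R * (p k)%:R / (q k)%:R * (q k)%:R = n%:R * (p k)%:R :> R.
    by rewrite divfK // gt_eqF.
  rewrite !(mulrBl, mulrDl, mulNr); lra.
have g_hi : gamma < (u%:~R + 2) / (q k)%:R.
  rewrite ltr_pdivlMr // uE.
  have : (n%:R * alpha + gamma - m%:~R) * (q k)%:R < 2 by rewrite -ltr_pdivlMr.
  have : 0 <= n%:R * e * (q k)%:R by rewrite mulr_ge0 // ltW.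
  have -> : n%:R * alpha = n%:R * (p k)%:R / (q k)%:R + n%:R * e by rewrite alE; ring.
  have : n%:R * (p k)%:R / (q k)%:R * (q k)%:R = n%:R * (p k)%:R :> R.
    by rewrite divfK // gt_eqF.
  rewrite !(mulrBl, mulrDl, mulNr); lra.
have u_lo : -2 < u.
  have := le_lt_trans g0 g_hi; rewrite pmulr_lgt0 ?invr_gt0 // => h.
  by rewrite -(ltr_int R) rmorphN /=; lra.
have u_hi : u < (q k)%:Z + 4.
  have := lt_trans g_lo g1; rewrite ltr_pdivrMr // mul1r => h.
  by rewrite -(ltr_int R) rmorphD /= -pmulrn; lra.
pose v := absz (u + P%:Z).
have vE : v%:Z = u + P%:Z.
  by rewrite /v gez0_abs //; clear -u_lo P4; lia.
have v_lt : (v < q k + 2 * P)%N by clear -vE u_hi P4; lia.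
have vP : coprime P v.
  have : coprime (n * p k) P.
    by rewrite coprimeMl nP (coprime_dvdr PQ) // (convergents_coprime cv).
  rewrite /coprime => /eqP co; rewrite -dvdn1 -co dvdn_gcd dvdn_gcdl andbT.
  have : (gcdn P v %| m * (q k)%:Z + P%:Z - v%:Z)%Z.
    rewrite rpredB ?rpredD //.
    - by rewrite dvdz_mull // dvdzE /= (dvdn_trans _ PQ) // dvdn_gcdl.
    - by rewrite dvdzE /= dvdn_gcdl.
    - by rewrite dvdzE /= dvdn_gcdr.
  suff -> : m * (q k)%:Z + P%:Z - v%:Z = (n * p k)%:Z by rewrite dvdzE.
  by rewrite vE /u PoszM; ring.
have vR : v%:R = u%:~R + P%:R :> R.
  by rewrite pmulrn vE rmorphD /= -pmulrn.
rewrite /near_coprime -(bigcup_mkord _ (coprime_window R P (q k))); exists v => //.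
by rewrite /coprime_window vP /= in_itv /= vR addrK g_lo g_hi.
Qed.

(** There are [(Q / P + 2) * totient P] windows, at most [3 * Q / P * totient P], each
    of length 6/Q. *)
Lemma near_coprime_measure (R : realType) (m Q : nat) :
  (0 < m)%N -> (modulus m %| Q)%N -> (0 < Q)%N ->
  (lebesgue_measure (near_coprime R (modulus m) Q) <= (36 / m%:R)%:E)%E.
Proof.
move=> m0 PQ Q0; set P := modulus m.
have P0 : (0 < P)%N by apply: fact_gt0.
have PleQ : (P <= Q)%N by apply: dvdn_leq.
rewrite /near_coprime.
set F := coprime_window R P Q.
have FE v : lebesgue_measure (F v) = ((coprime P v)%:R * (6 / Q%:R))%:E :> \bar R.
  rewrite /F /coprime_window; case: ifP => _; last by rewrite measure0 mul0r.
  rewrite lebesgue_measure_itv /= lte_fin ltr_pM2r ?invr_gt0 ?ltr0n //.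
  have -> : v%:R - P%:R - 4 < v%:R - P%:R + 2 :> R by lra.
  by rewrite -EFinB -mulrBl mul1r; congr (_%:E); congr (_ / _); lra.
apply: (@le_trans _ _ (\sum_(v < Q + 2 * P) lebesgue_measure (F v))%E).
  exact: outer_measure_subadditive.
apply: (@le_trans _ _ (\sum_(v < Q + 2 * P) ((coprime P v)%:R * (6 / Q%:R))%:E)%E).
  by apply: lee_sum => v _; rewrite FE.
rewrite sumEFin lee_fin -mulr_suml -natr_sum.
have [t Qt] := dvdnP PQ; rewrite -/P in Qt.
rewrite -(big_mkord predT (fun v => coprime P v : nat)).
rewrite {1}Qt -mulnDl sum_coprime_mul.
have := totient_fact_le m0; rewrite -/(modulus m) -/P => le.
rewrite mulrA ler_pdivrMr ?ltr0n // mulrAC ler_pdivlMr ?ltr0n //.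
rewrite -[6]/(6%:R) -[36]/(36%:R) -!natrM ler_nat.
have : (t + 2 <= 3 * t)%N by nia.
nia.
Qed.

Lemma modulus_coprime_prime (m n : nat) : prime n -> (2 ^ m < n)%N -> coprime n (modulus m).
Proof.
move=> pn lt; rewrite prime_coprime //; apply/negP => /(prime_dvd_fact_le pn).
by rewrite leqNgt lt.
Qed.

Lemma bigcup_tail_measure (R : realType) (E : nat -> set R) (e : nat -> R) (J : nat) (c : R) :
  (forall j, lebesgue_measure (E j) <= (e j)%:E)%E ->
  (forall N, \sum_(J <= j < N) e j <= c) ->
  (lebesgue_measure (\bigcup_(j in ~` `I_J) E j) <= c%:E)%E.
Proof.
move=> Ee sume.
apply: le_trans (outer_measure_sigma_subadditive_tail _ _ _) _.
apply: lime_le; first by apply: is_cvg_nneseries => *; apply: outer_measure_ge0.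
near=> N.
apply: (@le_trans _ _ (\sum_(J <= j < N) (e j)%:E)%E).
  by apply: lee_sum => j _; apply: Ee.
by rewrite sumEFin lee_fin.
Unshelve. all: by end_near.
Qed.

(** Comparison with a telescoping sum of powers of exponent - s, where the mean value
    estimate comes from the inequalities e^x >= 1 + x and ln (1 + x) <= x. *)
Lemma sum_powR_tail (R : realType) (s : R) (J N : nat) : 0 < s -> (0 < J)%N ->
  \sum_(J <= j < N) (j.+1%:R `^ (1 + s))^-1 <= (J%:R `^ s)^-1 / s.
Proof.
move=> s0 J0.
suff : (J <= N)%N -> \sum_(J <= j < N) (j.+1%:R `^ (1 + s))^-1 <=
  ((J%:R `^ s)^-1 - (N%:R `^ s)^-1) / s.
  have [JN /(_ isT) le|NJ _] := leqP J N.
    apply: le_trans le _; rewrite ler_pM2r ?invr_gt0 // gerBl invr_ge0 powR_ge0 //.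
  by rewrite big_geq ?(ltnW NJ) // divr_ge0 ?invr_ge0 ?powR_ge0 // ltW.
elim: N => [|N IH]; first by rewrite leqn0 => /eqP JE; rewrite JE in J0.
rewrite leq_eqVlt => /orP[/eqP<-|]; first by rewrite big_geq // subrr mul0r.
rewrite ltnS => JN; rewrite big_nat_recr //=.
have N0 : 0 < N%:R :> R by rewrite ltr0n (leq_trans J0).
have step : (N.+1%:R `^ (1 + s))^-1 <= ((N%:R `^ s)^-1 - (N.+1%:R `^ s)^-1) / s :> R.
  have M0 : 0 < N.+1%:R :> R by rewrite ltr0n.
  rewrite ler_pdivlMr // powRD ?pnatr_eq0 ?implybT // powRr1 ?(ltW M0) //.
  set x := N.+1%:R `^ s; have x0 : 0 < x by rewrite powR_gt0.
  have y0 : 0 < N%:R `^ s :> R by rewrite powR_gt0.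
  have ln_gap : N.+1%:R^-1 <= ln N.+1%:R - ln N%:R :> R.
    have := @le_ln1Dx R (- N.+1%:R^-1); rewrite ltrN2 invf_lt1 // ltr1n.
    have -> : 1 - N.+1%:R^-1 = N%:R / N.+1%:R :> R.
      by rewrite -natr1; field; rewrite natr1 gt_eqF.
    have N1 : (0 < N)%N by rewrite -(ltr0n R).
    rewrite ln_div ?posrE // ltnS N1 => /(_ isT) h.
    by rewrite -[leRHS]opprB lerNr.
  have yE : (N%:R `^ s)^-1 = x^-1 * expR (s * (ln N.+1%:R - ln N%:R)).
    have powE (z : R) : 0 < z -> z `^ s = expR (s * ln z).
      by move=> z0; rewrite /powR gt_eqF.
    by rewrite /x !powE // -!expRN -expRD; congr expR; ring.
  rewrite yE -[X in _ - X]mulr1 -mulrBr [_ * x]mulrC invfM -mulrA ler_pM2l ?invr_gt0 //.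
  rewrite lerBrDl; apply: le_trans (expR_ge1Dx _).
  by rewrite lerD2l mulrC ler_pM2l.
apply: le_trans (lerD (IH JN) step) _.
by rewrite -mulrDl ler_pM2r ?invr_gt0 // addrA subrK.
Qed.

(** * A function that is constant on each stage *)

Definition stage (N : nat -> nat) (unb : forall n, exists j, (n <= N j)%N) (n : nat) :=
  ex_minn (unb n).

Lemma leq_stage N unb n : (n <= N (@stage N unb n))%N.
Proof. by rewrite /stage; case: ex_minnP. Qed.

Lemma stage_le N unb n j : (n <= N j)%N -> (@stage N unb n <= j)%N.
Proof. by rewrite /stage; case: ex_minnP => i _ min /min. Qed.

Lemma stage_gt N unb n j : {homo N : i j / (i <= j)%N} ->
  (N j < n)%N -> (j < @stage N unb n)%N.
Proof.
move=> mono lt; rewrite ltnNge; apply/negP => /mono le.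
by have := leq_trans (leq_trans lt (leq_stage unb n)) le; rewrite ltnn.
Qed.

Lemma harmonic_unbounded (R : realType) (A : R) :
  exists J, A < \sum_(j < J) j.+2%:R^-1.
Proof.
apply/not_existsP => nex; apply: (@dvg_harmonic R).
apply: nondecreasing_is_cvgn.
  by apply/nondecreasing_seqP => n; rewrite seriesSr lerDl harmonic_ge0.
exists (1 + A) => _ [[|n] _ <-].
  rewrite /series /= big_geq //.
  have := nex 0%N; rewrite big_ord0 => /negP; rewrite -leNgt => A0.
  by rewrite addr_ge0.
rewrite /series /= big_nat_recl // big_mkord /= invr1 lerD2l leNgt.
by apply/negP; apply: nex.
Qed.

Lemma sum_prime_series_pinfty (R : realType) (psi : nat -> R) (Q N : nat -> nat) (C : nat) :
  (0 < C)%N -> (forall j, (0 < Q j)%N) -> {homo N : i j / (i <= j)%N} ->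
  (forall p, (0 < p)%N -> 0 <= psi p) ->
  (forall j p, (N j < p <= N j.+1)%N -> psi p = (Q j.+1)%:R^-1) ->
  (forall j, (Q j.+1 <= C * j.+2 *
     \sum_((N j).+1 <= p < (N j.+1).+1 | prime p) 1)%N) ->
  (\sum_(0 <= p <oo | prime p) (psi p)%:E = +oo)%E.
Proof.
move=> C0 Q0 mono psi0 psiE primes; apply/eqyP => A _.
have CR : 0 < C%:R :> R by rewrite ltr0n.
have [J ltJ] := harmonic_unbounded (C%:R * A).
have psi_ge0 p : (0 <= p)%N -> prime p -> (0 <= (psi p)%:E)%E.
  by move=> _ pp; rewrite lee_fin psi0 // prime_gt0.
apply: le_trans (nneseries_lim_ge (N J).+1 psi_ge0).
rewrite sumEFin lee_fin.
apply: (@le_trans _ _ (C%:R^-1 * \sum_(j < J) j.+2%:R^-1)).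
  by rewrite ler_pdivlMl // ltW.
elim: J {ltJ} => [|J IH].
  by rewrite big_ord0 mulr0 sumr_ge0 // => p pp; rewrite psi0 // prime_gt0.
rewrite big_ord_recr mulrDr (@big_cat_nat _ _ _ (N J).+1) //=; last by rewrite ltnS mono.
apply: lerD IH _.
have -> : \sum_((N J).+1 <= p < (N J.+1).+1 | prime p) psi p =
    (\sum_((N J).+1 <= p < (N J.+1).+1 | prime p) 1)%N%:R / (Q J.+1)%:R.
  rewrite natr_sum mulr_suml big_nat_cond [RHS]big_nat_cond.
  by apply: eq_bigr => p /andP[/andP[lo hi] _]; rewrite mul1r (psiE J) // lo -ltnS hi.
rewrite -invfM ler_pdivlMr ?ltr0n // mulrC ler_pdivrMr ?mulr_gt0 ?ltr0n //.
by rewrite mulrC -!natrM ler_nat primes.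
Qed.

(** A shift that is hit infinitely often is hit by a prime beyond the end of stage
    J, hence during a later stage.  That prime exceeds all the prime factors of
    the modulus of its stage, because the preceding stage ends beyond [2 ^ m]. *)
Lemma lebesgue_shifts_le (R : realType) (m a p q : nat -> nat) (alpha c : R)
  (unb : forall n, exists j, (n <= stage_end m q j)%N) (J : nat) :
  (forall j, (j.+2 <= m j)%N) -> {homo m : i j / (i <= j)%N} ->
  (forall j, (m j.+1 <= start (m j))%N) ->
  convergents a p q -> converges_to p q alpha -> scheduled m a q ->
  (forall N, \sum_(J.+1 <= j < N) 36 / (m j)%:R <= c) ->
  (lebesgue_measure [set gamma : R | (0 <= gamma < 1)%R /\
     infinite_set [set n : nat | prime n /\
       (dist_int (n%:R * alpha + gamma) <= (stage_denom m q (stage unb n))%:R^-1)%R]]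
   <= c%:E)%E.
Proof.
move=> jm mono mK cv al [dvdQ _ _] sumc.
pose E j := near_coprime R (modulus (m j)) (stage_denom m q j).
have Nmono := stage_end_mono cv mono.
have m0 j : (0 < m j)%N by apply: leq_trans (jm j).
have Ele j : (lebesgue_measure (E j) <= (36 / (m j)%:R)%:E)%E.
  have [q0 _] := convergents_growth cv (start (m j) + 3).
  exact: (near_coprime_measure R (m0 j) (dvdQ j) q0).
apply: le_trans (bigcup_tail_measure Ele sumc).
apply: le_outer_measure => gamma [g01 inf].
have [n [pn [dist Nn]]] : exists n, prime n /\
    dist_int (n%:R * alpha + gamma) <= (stage_denom m q (stage unb n))%:R^-1 /\
    (stage_end m q J < n)%N.
  apply: contrapT => nex; apply: inf.
  apply: (sub_finite_set _ (finite_II (stage_end m q J).+1)).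
  move=> n [pn dist] /=; rewrite ltnS leqNgt; apply/negP => lt.
  by apply: nex; exists n.
have Jj := stage_gt unb Nmono Nn.
set j := stage unb n in dist Jj.
exists j; first by apply/negP; rewrite -leqNgt.
have [i jE] : exists i, j = i.+1 by exists j.-1; rewrite prednK // (leq_ltn_trans _ Jj).
have Ni : (stage_end m q i < n)%N.
  by rewrite ltnNge; apply/negP => /(stage_le unb); rewrite -/j jE ltnn.
apply: (@mem_near_coprime R a p q alpha gamma _ (start (m j) + 3) n cv al _ (dvdQ j)) => //.
- apply: leq_trans (fact_geq _); apply: (@leq_trans (2 ^ 2)%N) => //.
  by rewrite leq_exp2l // (leq_trans _ (jm j)).
- apply: modulus_coprime_prime => //; apply: leq_ltn_trans Ni.
  apply: leq_trans (exp2_le_denom cv _); rewrite leq_exp2l // jE.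
  by apply: leq_trans (mK i) (leq_addr _ _).
- by have := leq_stage unb n; rewrite -/j /stage_end addnS.
Qed.

(** The function psi maps n to 1/Q, where Q is the denominator of the stage of n:
    it decreases because these denominators grow, and the primes of stage j
    contribute a constant multiple of 1/(j+1) to its sum. *)
Lemma scheduled_notin_bigcap_K_P (R : realType) (m a p q : nat -> nat)
  (alpha c : R) (J : nat) :
  (forall j, (j.+2 <= m j)%N) -> (forall j, (m j < m j.+1)%N) ->
  (forall j, (m j.+1 <= start (m j))%N) ->
  convergents a p q -> converges_to p q alpha -> scheduled m a q ->
  c < 1 -> (forall N, \sum_(J.+1 <= j < N) 36 / (m j)%:R <= c) ->
  ~ (\bigcap_(psi in @M_P R) K_P psi) alpha.
Proof.
move=> jm mlt mK cv al sch c1 sumc.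
have mono : {homo m : i j / (i <= j)%N}.
  by apply: homo_leq => // [y x z|k]; [exact: leq_trans|exact: ltnW].
have unb := stage_end_unbounded jm cv.
pose psi n : R := (stage_denom m q (stage unb n))%:R^-1.
have Q0 j : (0 < stage_denom m q j)%N.
  by have [] := convergents_growth cv (start (m j) + 3).
have Nmono := stage_end_mono cv mono.
suff psiM : @M_P R psi.
  move=> /(_ psi psiM)[_ measure1].
  have := @lebesgue_shifts_le R m a p q alpha c unb J jm mono mK cv al sch sumc.
  by rewrite measure1 lee_fin leNgt c1.
split.
- by move=> n _; rewrite invr_ge0.
- move=> i j i0 ij; rewrite lef_pV2 ?posrE ?ltr0n // ler_nat.
  apply: (denom_mono cv); rewrite leq_add2r leq_exp2l // leq_exp2l // mono //.
  by apply: stage_le; apply: leq_trans ij (leq_stage _ _).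
apply: (@sum_prime_series_pinfty _ _ (stage_denom m q) (stage_end m q) 24) => //.
- by move=> n _; rewrite invr_ge0.
- move=> j n /andP[lo hi]; rewrite /psi; congr ((stage_denom m q _)%:R^-1).
  by apply/eqP; rewrite eqn_leq stage_le // stage_gt.
- exact: (stage_primes jm mlt cv sch).
Qed.

(** * Choice of the parameters *)

(** The summand [j.+2] gives at once the lower bound that the stages require and
    strict monotonicity, without changing the order of magnitude for t >= 1. *)
Definition exponent (R : realType) (t : R) (j : nat) : nat :=
  (j.+2 + Num.truncn (j.+1%:R `^ t))%N.

Lemma exponent_ge (R : realType) (t : R) j : j.+1%:R `^ t <= (exponent t j)%:R.
Proof.
apply/ltW; apply: lt_le_trans (truncnS_gt _) _.
by rewrite ler_nat /exponent addSn ltnS leq_addl.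
Qed.

Lemma exponent_le (R : realType) (t : R) j :
  (exponent t j)%:R <= j.+2%:R + j.+1%:R `^ t.
Proof.
by rewrite natrD lerD2l truncn_le // powR_ge0.
Qed.

Lemma exponent_lt (R : realType) (t : R) j : 0 <= t ->
  (exponent t j < exponent t j.+1)%N.
Proof.
move=> t0; rewrite /exponent -addSn leq_add //.
by apply: le_truncn; apply: ge0_ler_powR; rewrite ?nnegrE ?ler_nat.
Qed.

Lemma exponent_le_start (R : realType) (t : R) j : t <= 2 ->
  (exponent t j.+1 <= start (exponent t j))%N.
Proof.
move=> t2; apply: (@leq_trans (2 ^ 8 ^ j.+2)); last first.
  by rewrite leq_exp2l // leq_exp2l // leq_addr.
apply: (@leq_trans (2 * j.+2 ^ 2)).
  rewrite -(ler_nat R); apply: le_trans (exponent_le _ _) _.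
  apply: (@le_trans _ _ (j.+3%:R + j.+2%:R ^+ 2)).
    by rewrite lerD2l -powR_mulrn // ler_powR // ler1n.
  by rewrite -natrX -natrD ler_nat; lia.
apply: (@leq_trans (2 ^ (2 * j + 5))).
  have : (j < 2 ^ j)%N by apply: ltn_expl.
  rewrite expnD mulnC [(2 * j)%N]mulnC expnM; set x := (2 ^ j)%N.
  rewrite -[(2 ^ 5)%N]/32%N -[(x ^ 2)%N]/(x * x)%N -[(j.+2 ^ 2)%N]/(j.+2 * j.+2)%N.
  nia.
rewrite leq_exp2l // !expnS; have : (j < 8 ^ j)%N by apply: ltn_expl.
lia.
Qed.

Lemma exponent_powR_le (R : realType) (beta : R) j : 0 < beta <= 1 ->
  (3 * exponent beta^-1 j + 3)%:R `^ beta <= 12 * j.+1%:R.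
Proof.
move=> /andP[b0 b1]; set t := beta^-1.
have t1 : 1 <= t by rewrite invf_ge1.
have j1 : 1 <= j.+1%:R :> R by rewrite ler1n.
have le : (3 * exponent t j + 3)%:R <= 12 * j.+1%:R `^ t :> R.
  have h1 := exponent_le t j; have h2 : j.+1%:R <= j.+1%:R `^ t by apply: le1r_powR.
  rewrite natrD natrM; move: h1; rewrite -[j.+2%:R]natr1; lra.
apply: (@le_trans _ _ ((12 * j.+1%:R `^ t) `^ beta)).
  by apply: ge0_ler_powR; rewrite ?nnegrE ?mulr_ge0 ?powR_ge0 // ltW.
rewrite powRM ?powR_ge0 // -powRrM mulVf ?gt_eqF // powRr1 ?(le_trans ler01) //.
by rewrite ler_wpM2r ?ler1_powR //; lra.
Qed.

Lemma exponent_sum_le (R : realType) (s : R) : 0 < s ->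
  exists J, forall N, \sum_(J.+1 <= j < N) 36 / (exponent (1 + s) j)%:R <= 2^-1 :> R.
Proof.
(* This makes the bound 36 x^-s / s of the tail equal to 1/2. *)
move=> s0; pose x := (72 / s) `^ s^-1.
exists (Num.truncn x) => N.
have le : \sum_((Num.truncn x).+1 <= j < N) 36 / (exponent (1 + s) j)%:R <=
    36 * \sum_((Num.truncn x).+1 <= j < N) (j.+1%:R `^ (1 + s))^-1 :> R.
  rewrite mulr_sumr; apply: ler_sum => j _; rewrite ler_pM2l // lef_pV2 ?posrE.
  - exact: exponent_ge.
  - by rewrite ltr0n /exponent.
  - by rewrite powR_gt0.
apply: le_trans le _.
have y0 : 0 < 72 / s by rewrite divr_gt0.
have xs : 72 / s <= (Num.truncn x).+1%:R `^ s.
  apply: (@le_trans _ _ (x `^ s)).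
    by rewrite /x -powRrM mulVf ?gt_eqF // powRr1 // ltW.
  apply: ge0_ler_powR; rewrite ?nnegrE ?powR_ge0 // ?(ltW s0) //.
  by apply/ltW/truncnS_gt.
apply: (@le_trans _ _ (36 * (((Num.truncn x).+1%:R `^ s)^-1 / s))).
  by rewrite ler_pM2l // sum_powR_tail.
have : ((Num.truncn x).+1%:R `^ s)^-1 <= (72 / s)^-1.
  by rewrite lef_pV2 ?posrE // powR_gt0.
rewrite -(ler_pM2r (_ : 0 < s^-1)) ?invr_gt0 // => h.
apply: (@le_trans _ _ (36 * ((72 / s)^-1 / s))); first by rewrite ler_pM2l.
by rewrite invf_div mulrAC divff ?gt_eqF //; lra.
Qed.

Theorem proposition16 (R : realType) (eps : R) (eps_gt0 : 0 < eps) :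
  exists alpha : R,
    [/\ 0 <= alpha < 1,
        BAD (log_over_logloglog_pow (1 - eps)) alpha
      & ~ (\bigcap_(psi in @M_P R) K_P psi) alpha].
Proof.
(* The bound t <= 2 ensures that a stage ends beyond the Y of the next one. *)
pose beta : R := Num.max (1 - eps) 2^-1.
have beta_ge : 2^-1 <= beta by rewrite le_max lexx orbT.
have beta_eps : 1 - eps <= beta by rewrite le_max lexx.
have beta_lt : beta < 1 by rewrite gt_max; apply/andP; split; lra.
have beta0 : 0 < beta by lra.
pose t := beta^-1; pose s := t - 1.
have t2 : t <= 2 by rewrite -[2]invrK lef_pV2 ?posrE.
have t1 : 1 < t by rewrite invf_gt1.
have s0 : 0 < s by rewrite subr_gt0.
pose m := exponent t.
have jm j : (j.+2 <= m j)%N by rewrite leq_addr.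
have mlt j : (m j < m j.+1)%N by apply: exponent_lt; lra.
have mK j : (m j.+1 <= start (m j))%N by apply: exponent_le_start.
have m_inj : injective m.
  apply/incn_inj/leq_mono; apply: homo_ltn mlt => y x z; exact: ltn_trans.
have [a [p [q [cv sch]]]] := ex_scheduled jm m_inj.
have [alpha al] := ex_converges_to R cv.
have [J sumJ] := exponent_sum_le s0.
exists alpha; split.
- have := al 0%N; case: cv => -[-> _ -> ->] _.
  by rewrite mul0r subr0 mul1r => /andP[-> le] /=; apply: le_lt_trans le _; lra.
- apply: (BAD_scheduled (beta := beta) (C := 12) jm cv al sch).
  + by rewrite beta_eps ltW.
  + exact: ltW.
  + lra.
  + by move=> j; apply: exponent_powR_le; rewrite beta0 ltW.
- apply: (scheduled_notin_bigcap_K_P (c := 2^-1) (J := J) jm mlt mK cv al sch); first by lra.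
  by move=> N; have := sumJ N; rewrite /s addrC subrK.
Qed.
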